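(* Let $a \geq 1$ be an integer, let $\ell = 2a$, and define the subsets of $\mathbb{Z}_{\ell^2+1}$ $$A_0 = \{0,\dots,a-1\}\cup\{2a,\dots,3a-1\}, \qquad A_1 = \{(4i-1)a,\ 4ia : i=1,\dots,a\}.$$ Suppose $m \geq 3$. Then no $(\ell^2+1, m, \ell; 1)$-SCEDF in $\mathbb{Z}_{\ell^2+1}$ can contain $A_0$ or $A_1$ as one of its $m$ sets.
   Context: For two disjoint subsets $A,B$ of an additive abelian group $G$, $\mathcal{D}(B,A)$ denotes the multiset $\{y-x : y\in B, x\in A\}$. An $(n,m,\ell;\lambda)$-strong circular external difference family, or $(n,m,\ell;\lambda)$-SCEDF, in an additive abelian group $G$ of order $n$ is a family of $m$ pairwise disjoint $\ell$-subsets $B_0,\dots,B_{m-1}$ of $G$ such that, for every $j$ with $0\leq j\leq m-1$, the multiset equation $\mathcal{D}(B_{j+1\bmod m},B_j)=\lambda(G\setminus\{0\})$ holds, i.e. each nonzero element of $G$ occurs exactly $\lambda$ times. *)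

(* Defs.v *)
From mathcomp Require Import all_boot all_order all_algebra.

Set Implicit Arguments.
Unset Strict Implicit.
Unset Printing Implicit Defensive.

Import GRing.Theory.
Local Open Scope ring_scope.

(* Multisets are represented by sequences, multiplicities by [count_mem]. *)
Definition diff_multiset (G : finZmodType) (B A : {set G}) : seq G :=
  [seq y - x | y <- enum B, x <- enum A].

(* [ordS j] is the ordinal j + 1 mod m. *)
Definition SCEDF (G : finZmodType) (n m l lambda : nat)
    (B : 'I_m -> {set G}) : Prop :=
  [/\ #|G| = n,
      forall i j : 'I_m, i != j -> [disjoint B i & B j],
      forall j : 'I_m, #|B j| = l
    & forall (j : 'I_m) (g : G),
        count_mem g (diff_multiset (B (ordS j)) (B j)) =
          (if g == 0%R then 0 else lambda)%N].

(* For n <= 1 the type 'Z_n is Z/2; these sets are meant for n > 1. *)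
Definition A0 (n a : nat) : {set 'Z_n} :=
  [set:: [seq k%:R | k <- iota 0 a ++ iota (2 * a)%N a]].

(* [iota 1 a] enumerates i = 1, ..., a; the truncated subtraction 4 * i - 1
   is therefore the integer one. *)
Definition A1 (n a : nat) : {set 'Z_n} :=
  [set:: [seq ((4 * i - 1) * a)%N%:R | i <- iota 1 a] ++
         [seq (4 * i * a)%N%:R | i <- iota 1 a]].

(* Main.v *)
(* If [B A^(-1) = C B^(-1) = lambda (G - 1)] in the group ring of [G], then
   expanding [C B^(-1) A] in two ways gives
   [lambda (#|A| G - A) = lambda (#|C| G - C)], so [A = C] as soon as
   [#|A| = #|C|] and [lambda > 0].  Hence [B_(j+2) = B_j] in every SCEDF, which
   contradicts disjointness when [m >= 3], whatever the sets [B_j] are. *)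
Require Import Defs.
From mathcomp Require Import all_boot all_order all_algebra.
From mathcomp Require Import zify.

Import GRing.Theory.

Lemma count_diff_multiset (G : finZmodType) (B A : {set G}) (g : G) :
  count_mem g (diff_multiset B A) =
  \sum_(y in B) \sum_(x in A) (y - x == g)%R.
Proof.
rewrite -sum1_count big_mkcond /= big_allpairs_dep !big_enum /=.
by apply: eq_bigr => y _; rewrite big_enum; apply: eq_bigr => x _; case: eqP.
Qed.

(** The sum lacks one term [lambda] exactly when [g] lies in [A]. Given [#|A|] and [lambda > 0], it
    thus detects membership of [g]. *)
Lemma sum_if_eq_mem (T : finType) (A : {set T}) (g : T) (lambda : nat) :
  \sum_(x in A) (if x == g then 0 else lambda) + lambda * (g \in A) =
  lambda * #|A|.
Proof.
have [gA|gA] := boolP (g \in A).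
  rewrite (bigD1 g) //= eqxx add0n muln1 (cardsD1 g) gA mulnDr muln1 addnC.
  congr (_ + _); rewrite mulnC -sum_nat_const.
  by apply: eq_big => [x|x /andP[_ /negPf->]//]; rewrite !inE andbC.
rewrite muln0 addn0 mulnC -sum_nat_const; apply: eq_bigr => x xA.
by case: eqP => // xg; rewrite -xg xA in gA.
Qed.

Lemma diff_multiset_cancel (G : finZmodType) (lambda : nat) (A B C : {set G}) :
    0 < lambda -> #|A| = #|C| ->
    (forall g, count_mem g (diff_multiset B A) =
       if g == 0%R then 0 else lambda) ->
    (forall g, count_mem g (diff_multiset C B) =
       if g == 0%R then 0 else lambda) ->
  A = C.
Proof.
move=> lambda_gt0 eqAC BA CB; apply/setP => g.
have eqS : \sum_(x in A) (if x == g then 0 else lambda) =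
           \sum_(z in C) (if z == g then 0 else lambda).
  (* The middle term counts the triples with [z - y + x = g]. Fixing [x] brings in [CB], fixing [z]
     brings in [BA]. *)
  transitivity (\sum_(x in A) \sum_(z in C) \sum_(y in B) (z - y == g - x)%R).
    apply: eq_bigr => x _.
    by rewrite -count_diff_multiset CB subr_eq0 eq_sym.
  rewrite exchange_big; apply: eq_bigr => z _.
  rewrite exchange_big -subr_eq0 -BA count_diff_multiset.
  apply: eq_bigr => y _; apply: eq_bigr => x _; congr nat_of_bool.
  (* Both equations say [z + x = g + y]. *)
  by rewrite [RHS]eq_sym !subr_eq addrAC [(g + y)%R]addrC addrAC.
have := sum_if_eq_mem _ A g lambda.
rewrite eqS eqAC -(sum_if_eq_mem _ C g lambda).
by move/addnI/eqP; rewrite eqn_pmul2l //; do 2!case: (g \in _).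
Qed.

Lemma ordSS_neq (m : nat) (j : 'I_m) : 2 < m -> j != ordS (ordS j).
Proof.
move=> m_gt2; apply/eqP => /(congr1 val) /=.
have [lt1|ge1] := ltnP j.+1 m; last first.
  (* The first step wraps to 0 and the second reaches 1, whereas [j = m - 1 >= 2]. *)
  have -> : j.+1 = m by have := ltn_ord j; lia.
  by rewrite modnn modn_small; lia.
rewrite (modn_small lt1); have [lt2|ge2] := ltnP j.+2 m.
  by rewrite modn_small; lia.
(* The second step wraps to 0, whereas [j = m - 2 > 0]. *)
have -> : j.+2 = m by lia.
by rewrite modnn; lia.
Qed.

Lemma SCEDF_le2 (G : finZmodType) (n m l lambda : nat) (B : 'I_m -> {set G}) :
  0 < l -> 0 < lambda -> SCEDF n l lambda B -> m <= 2.
Proof.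
move=> l_gt0 lambda_gt0 [_ disjB cardB diffB]; rewrite leqNgt.
apply/negP => m_gt2; pose j : 'I_m := Ordinal (ltnW (ltnW m_gt2)).
have eqB : B j = B (ordS (ordS j)).
  by apply: diff_multiset_cancel lambda_gt0 _ (diffB j) (diffB _); rewrite !cardB.
have := disjB _ _ (ordSS_neq _ j m_gt2).
(* [B j] is disjoint from itself, hence empty, against [l > 0]. *)
by rewrite -eqB -setI_eq0 setIid -cards_eq0 cardB -leqn0 leqNgt l_gt0.
Qed.

Theorem corollary3p18 (a l m : nat) (ha : 1 <= a) (hl : l = 2 * a)
    (hm : 3 <= m) (B : 'I_m -> {set 'Z_(l ^ 2 + 1)}) :
  SCEDF (l ^ 2 + 1) l 1 B ->
  ~ (exists j : 'I_m, B j = A0 (l ^ 2 + 1) a \/ B j = A1 (l ^ 2 + 1) a).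
Proof.
move=> scedfB _; have l_gt0 : 0 < l by rewrite hl muln_gt0.
by have := SCEDF_le2 _ _ _ _ 1 _ l_gt0 isT scedfB; rewrite leqNgt hm.
Qed.
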